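(* Let $\mathcal{A}_d:Q\times Q\to G$ be a discrete connection $1$-form. Then $$\varphi:(Q\times Q)/G\to\tilde{G},\qquad \varphi([q_0,q_1]_G)=[q_0,\mathcal{A}_d(q_0,q_1)]_G,$$ is a (well-defined) splitting of the discrete Atiyah sequence, that is, $\varphi\circ i=1_{\tilde{G}}$.
   Context: $Q$ is a smooth manifold with a free smooth left action $(g,q)\mapsto gq$ of a Lie group $G$ such that the projection $\pi:Q\to S=Q/G$ is a submersion. $G$ acts on $Q\times Q$ diagonally, and $\tilde{G}=(Q\times G)/G$ for the action $k(q,g)=(kq,kgk^{-1})$; classes are denoted $[\cdot,\cdot]_G$. The discrete Atiyah sequence is $0\to\tilde{G}\xrightarrow{\,i\,}(Q\times Q)/G\xrightarrow{(\pi,\pi)}S\times S\to0$, with $i([q,g]_G)=[q,gq]_G$ and $(\pi,\pi)([q_0,q_1]_G)=(\pi q_0,\pi q_1)$. A discrete connection $1$-form satisfies $\mathcal{A}_d(gq_0,gq_1)=g\,\mathcal{A}_d(q_0,q_1)\,g^{-1}$ and $\mathcal{A}_d(q,gq)=g$ for all $g\in G$, $q,q_0,q_1\in Q$. *)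

(* Defs.v *)
From HB Require Import structures.
From mathcomp Require Import all_boot all_order all_algebra.
From mathcomp Require Import all_classical all_reals all_analysis.

Set Implicit Arguments.
Unset Strict Implicit.
Unset Printing Implicit Defensive.

Import Order.TTheory GRing.Theory Num.Theory.
Import numFieldNormedType.Exports.

Local Open Scope classical_set_scope.
Local Open Scope ring_scope.
Local Open Scope quotient_scope.

(** * Smooth manifolds, Lie groups, submersions *)

(* [U] is meant to be open. [f] is C^(k+1) iff it is differentiable on [U]
   and all its directional derivatives are C^k. *)
Fixpoint class_Ck (R : realType) (E F : normedModType R) (k : nat)
    (U : set E) (f : E -> F) : Prop :=
  match k with
  | 0%N => forall x, U x -> {for x, continuous f}
  | k'.+1 => (forall x, U x -> differentiable f x) /\
             (forall v : E, class_Ck k' U (fun x => 'D_v f x))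
  end.

Definition smooth_on (R : realType) (E F : normedModType R)
    (U : set E) (f : E -> F) : Prop :=
  forall k, class_Ck k U f.

(* [coord] and [param] are total functions, but only the restrictions of
   [coord] to [dom] and of [param] to [coord @` dom] are meaningful. *)
Record chart (R : realType) (E : normedModType R) (T : topologicalType) :=
  Chart { dom : set T ; coord : T -> E ; param : E -> T }.

Definition is_chart (R : realType) (E : normedModType R) (T : topologicalType)
    (c : chart E T) : Prop :=
  [/\ open (dom c),
      open (coord c @` dom c),
      forall x, dom c x -> param c (coord c x) = x,
      forall x, dom c x -> {for x, continuous (coord c)} &
      forall y, (coord c @` dom c) y -> {for y, continuous (param c)}].

Definition smooth_transition (R : realType) (E : normedModType R)
    (T : topologicalType) (c d : chart E T) : Prop :=
  smooth_on (coord c @` (dom c `&` dom d)) (coord d \o param c).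

(* The atlas need not be maximal: the notions of smooth map and of submersion
   below do not depend on the choice of a compatible atlas. *)
Record smooth_manifold (R : realType) (n : nat) (T : topologicalType) :=
  SmoothManifold {
    atlas :> set (chart 'rV[R]_n T) ;
    atlas_hausdorff : hausdorff_space T ;
    atlas_second_countable : @second_countable T ;
    atlas_chart : forall c, atlas c -> is_chart c ;
    atlas_cover : forall x : T, exists2 c, atlas c & dom c x ;
    atlas_transition : forall c d, atlas c -> atlas d -> smooth_transition c d
  }.

Definition prod_chart (R : realType) (E F : normedModType R)
    (T U : topologicalType) (c : chart E T) (d : chart F U) :
    chart (E * F)%type (T * U)%type :=
  Chart (dom c `*` dom d)
        (fun p => (coord c p.1, coord d p.2))
        (fun y => (param c y.1, param d y.2)).

Definition prod_atlas (R : realType) (E F : normedModType R)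
    (T U : topologicalType) (A : set (chart E T)) (B : set (chart F U)) :
    set (chart (E * F)%type (T * U)%type) :=
  [set e | exists c d, [/\ A c, B d & e = prod_chart c d]].

Definition local_expr (R : realType) (E F : normedModType R)
    (T U : topologicalType) (c : chart E T) (d : chart F U) (f : T -> U) :
    E -> F :=
  coord d \o f \o param c.

Definition smooth_map (R : realType) (E F : normedModType R)
    (T U : topologicalType) (A : set (chart E T)) (B : set (chart F U))
    (f : T -> U) : Prop :=
  continuous f /\
  forall c d, A c -> B d ->
    smooth_on (coord c @` (dom c `&` f @^-1` dom d)) (local_expr c d f).

Definition submersion (R : realType) (E F : normedModType R)
    (T U : topologicalType) (A : set (chart E T)) (B : set (chart F U))
    (f : T -> U) : Prop :=
  smooth_map A B f /\
  forall c d x, A c -> B d -> dom c x -> dom d (f x) ->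
    forall w : F, exists v : E, 'd (local_expr c d f) (coord c x) v = w.

(* A type carrying both a topology and an (unrelated) abstract group law. *)
#[short(type="topGroupType")]
HB.structure Definition TopGroup := {G of Topological G & Group G}.

Definition lie_group (R : realType) (k : nat) (G : topGroupType)
    (MG : smooth_manifold R k G) : Prop :=
  smooth_map (prod_atlas MG MG) MG (fun p : G * G => (p.1 * p.2)%g) /\
  smooth_map MG MG (fun g : G => (g^-1)%g).

(** * Left actions and orbit spaces *)

Record left_action (G : topGroupType) (X : topologicalType) := LeftAction {
  act :> G -> X -> X ;
  act1 : forall x, act 1%g x = x ;
  actM : forall g h x, act (g * h)%g x = act g (act h x)
}.

Definition smooth_action (R : realType) (k n : nat) (G : topGroupType)
    (X : topologicalType) (MG : smooth_manifold R k G)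
    (MX : smooth_manifold R n X) (a : left_action G X) : Prop :=
  smooth_map (prod_atlas MG MX) MX (fun p : G * X => a p.1 p.2).

Definition free_action (G : topGroupType) (X : topologicalType)
    (a : left_action G X) : Prop :=
  forall g x, a g x = x -> g = 1%g.

Section OrbitSpace.
Variables (G : topGroupType) (X : topologicalType) (a : left_action G X).

Definition same_orbit : rel X := fun x y => `[< exists g, y = a g x >].

Lemma same_orbit_refl : reflexive same_orbit.
Proof. by move=> x; apply/asboolP; exists 1%g; rewrite act1. Qed.

Lemma same_orbit_sym : symmetric same_orbit.
Proof.
have H x y : same_orbit x y -> same_orbit y x.
  move=> /asboolP[g ->]; apply/asboolP; exists (g^-1)%g.
  by rewrite -actM mulVg act1.
by move=> x y; apply/idP/idP; exact: H.
Qed.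

Lemma same_orbit_trans : transitive same_orbit.
Proof.
move=> y x z /asboolP[g ->] /asboolP[h ->]; apply/asboolP.
by exists (h * g)%g; rewrite actM.
Qed.

Definition orbit_equiv : equiv_rel X :=
  EquivRel same_orbit same_orbit_refl same_orbit_sym same_orbit_trans.

Definition orbit_space : topologicalType :=
  quotient_topology {eq_quot orbit_equiv}.

Definition orbit_class (x : X) : orbit_space :=
  \pi_{eq_quot orbit_equiv} x.

Lemma orbit_classP x y :
  orbit_class x = orbit_class y <-> exists g, y = a g x.
Proof.
split=> [/eqmodP/asboolP //|H].
by apply/eqmodP/asboolP.
Qed.

Lemma orbit_class_surj (c : orbit_space) : exists x, c = orbit_class x.
Proof.
exists (repr (c : {eq_quot orbit_equiv})).
by rewrite /orbit_class reprK.
Qed.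

(* The map induced by [f] on orbits, computed on a chosen representative; it
   is the expected one when [f] is constant on orbits (see [descendE]). *)
Definition descend (Y : Type) (f : X -> Y) (c : orbit_space) : Y :=
  f (repr (c : {eq_quot orbit_equiv})).

Lemma descendE (Y : Type) (f : X -> Y) :
  (forall g x, f (a g x) = f x) -> forall x, descend f (orbit_class x) = f x.
Proof.
move=> fa x; rewrite /descend.
set y := repr _.
have /orbit_classP[g ->] : orbit_class x = orbit_class y.
  by rewrite /orbit_class /y reprK.
by rewrite fa.
Qed.

End OrbitSpace.

(** * The discrete Atiyah sequence *)

Section DiscreteAtiyah.
Variables (G : topGroupType) (Q : topologicalType) (a : left_action G Q).

Definition diag_act (g : G) (p : Q * Q) : Q * Q := (a g p.1, a g p.2).

Lemma diag_act1 p : diag_act 1%g p = p.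
Proof. by case: p => x y; rewrite /diag_act !act1. Qed.

Lemma diag_actM g h p : diag_act (g * h)%g p = diag_act g (diag_act h p).
Proof. by rewrite /diag_act !actM. Qed.

Definition diagonal_action : left_action G (Q * Q)%type :=
  LeftAction diag_act1 diag_actM.

Definition conj_act (k : G) (p : Q * G) : Q * G :=
  (a k p.1, (k * p.2 * k^-1)%g).

Lemma conj_act1 p : conj_act 1%g p = p.
Proof. by case: p => x y; rewrite /conj_act act1 /= invg1 mul1g mulg1. Qed.

Lemma conj_actM g h p : conj_act (g * h)%g p = conj_act g (conj_act h p).
Proof. by rewrite /conj_act actM /= invgM !mulgA. Qed.

Definition conjugation_action : left_action G (Q * G)%type :=
  LeftAction conj_act1 conj_actM.

Definition pair_space : topologicalType := orbit_space diagonal_action.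

Definition pair_class (q0 q1 : Q) : pair_space :=
  orbit_class diagonal_action (q0, q1).

Definition gtilde : topologicalType := orbit_space conjugation_action.

Definition gtilde_class (q : Q) (g : G) : gtilde :=
  orbit_class conjugation_action (q, g).

Definition atiyah_inj : gtilde -> pair_space :=
  descend (fun p : Q * G => pair_class p.1 (a p.2 p.1)).

Lemma atiyah_injE q g : atiyah_inj (gtilde_class q g) = pair_class q (a g q).
Proof.
rewrite /atiyah_inj /gtilde_class descendE //= => k [x h] /=.
apply/esym/orbit_classP; exists k.
by rewrite /= /diag_act /= -!actM mulgVK.
Qed.

Definition atiyah_proj : pair_space -> orbit_space a * orbit_space a :=
  descend (fun p : Q * Q => (orbit_class a p.1, orbit_class a p.2)).

Lemma atiyah_projE q0 q1 :
  atiyah_proj (pair_class q0 q1) = (orbit_class a q0, orbit_class a q1).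
Proof.
rewrite /atiyah_proj /pair_class descendE //= => k [x y] /=.
by congr pair; apply/esym/orbit_classP; exists k.
Qed.

End DiscreteAtiyah.

Record short_sequence := ShortSequence {
  left_term : Type ;
  middle_term : Type ;
  right_term : Type ;
  seq_inj : left_term -> middle_term ;
  seq_proj : middle_term -> right_term
}.

Definition discrete_atiyah_sequence (G : topGroupType) (Q : topologicalType)
    (a : left_action G Q) : short_sequence :=
  ShortSequence (@atiyah_inj G Q a) (@atiyah_proj G Q a).

Definition splitting (E : short_sequence)
    (phi : middle_term E -> left_term E) : Prop :=
  phi \o @seq_inj E = id.

Record discrete_connection_form (G : topGroupType) (Q : topologicalType)
    (a : left_action G Q) (Ad : Q * Q -> G) : Prop := DiscreteConnectionForm {
  dcf_equivariant : forall g q0 q1,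
    Ad (a g q0, a g q1) = (g * Ad (q0, q1) * g^-1)%g ;
  dcf_vertical : forall g q, Ad (q, a g q) = g
}.

(* Main.v *)
Require Import Defs.
From mathcomp Require Import all_boot all_order all_algebra.
From mathcomp Require Import all_classical all_reals all_analysis.

(** Equivariance of [Ad] says that moving [(q0, q1)] diagonally by [g] moves [(q0, Ad (q0, q1))] by
    the conjugation action of the same [g], so the formula descends to orbits. Since the injection
    sends the class of [(q, g)] to that of [(q, a g q)], the condition [Ad (q, a g q) = g] makes
    [phi] undo it. *)

Theorem lemma4p9 (R : realType) (n k s : nat)
    (Q : topologicalType) (MQ : smooth_manifold R n Q)
    (G : topGroupType) (MG : smooth_manifold R k G) (HG : lie_group MG)
    (a : left_action G Q) (Ha : smooth_action MG MQ a) (Hfree : free_action a)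
    (MS : smooth_manifold R s (orbit_space a))
    (Hpi : submersion MQ MS (orbit_class a))
    (Ad : Q * Q -> G) (HAd : discrete_connection_form a Ad) :
  exists phi : pair_space a -> gtilde a,
    (forall q0 q1 : Q,
       phi (pair_class a q0 q1) = gtilde_class a q0 (Ad (q0, q1))) /\
    splitting (E := discrete_atiyah_sequence a) phi.
Proof.
pose phi : pair_space a -> gtilde a :=
  descend (fun p : Q * Q => gtilde_class a p.1 (Ad p)).
have phiE q0 q1 :
    phi (pair_class a q0 q1) = gtilde_class a q0 (Ad (q0, q1)).
  (* [descend] evaluates at a chosen representative; the formula holds at every pair once it is
     shown constant on diagonal orbits. *)
  rewrite /phi /pair_class descendE // => g [x y] /=.
  apply/esym/orbit_classP; exists g.
  by rewrite /= /diag_act /conj_act /= (dcf_equivariant HAd).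
exists phi; split => //; apply/funext => c.
(* A representative of [c] turns the identity into an explicit computation. *)
have [[q g] ->] := orbit_class_surj c.
by rewrite /= -/(gtilde_class a q g) atiyah_injE phiE (dcf_vertical HAd).
Qed.
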